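(* Let $V=\{(x_1,\dots,x_6)\in\mathbb{C}^6\mid x_1+\cdots+x_6=0\}$ and, for each two-element subset $\{i,j\}\subset\{1,\dots,6\}$, let $z_{ij}=[v_{ij}]\in\mathbb{P}(V)\simeq\mathbb{P}^4$, where $v_{ij}=e_i+e_j-\frac13(e_1+\cdots+e_6)$. For three distinct two-element subsets $\{a,b\},\{c,d\},\{e,f\}$ of $\{1,\dots,6\}$, the three points $z_{ab},z_{cd},z_{ef}$ are collinear if and only if $(ab\mid cd\mid ef)$ is a syntheme. Moreover, the fifteen points $z_{ij}$ and the fifteen lines $L_{ab|cd|ef}=\langle z_{ab},z_{cd},z_{ef}\rangle$, indexed by the synthemes $(ab\mid cd\mid ef)$, form a $(15_3,15_3)$-configuration, which means that each line contains three of the points and each point lies on three of the lines.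
   Context: $e_1,\dots,e_6$ is the standard basis of $\mathbb{C}^6$, and $\mathbb{P}(V)$ is the projective space of one-dimensional subspaces of $V$. A syntheme is a partition of $\{1,\dots,6\}$ into three unordered pairs, written $(ab\mid cd\mid ef)$; there are fifteen synthemes. $\langle\cdot\rangle$ denotes projective linear span. *)

(* Defs.v *)
From HB Require Import structures.
From mathcomp Require Import all_boot all_order all_algebra.
From mathcomp Require Import reals.
From mathcomp Require Import complex.

Set Implicit Arguments.
Unset Strict Implicit.
Unset Printing Implicit Defensive.

Import Order.TTheory GRing.Theory Num.Theory.
Local Open Scope ring_scope.

(* The field of complex numbers is R[i] with R : realType. *)

(* P(V), for V a subspace of E.  A linear subspace of P(V) is encoded by the
   vector subspace W of V of which it is the projectivization, so that its
   projective dimension is \dim W - 1. *)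
Definition proj (K : fieldType) (E : vectType K) (V : {vspace E}) : Type :=
  {U : {vspace E} | (U <= V)%VS && (\dim U == 1%N)}.

Lemma proj_line_subproof (K : fieldType) (E : vectType K) (V : {vspace E})
    (v : E) :
  v \in V -> v != 0 -> (<[v]> <= V)%VS && (\dim <[v]> == 1%N).
Proof. by move=> vV v0; rewrite -memvE vV dim_vline v0. Qed.

(* The point [v] of P(V) *)
Definition proj_pt (K : fieldType) (E : vectType K) (V : {vspace E})
    (v : E) (vV : v \in V) (v0 : v != 0) : proj V :=
  exist _ <[v]>%VS (proj_line_subproof vV v0).

Definition lies_on (K : fieldType) (E : vectType K) (V : {vspace E})
    (p : proj V) (W : {vspace E}) : bool := (sval p <= W)%VS.

Definition is_line (K : fieldType) (E : vectType K) (V W : {vspace E}) : bool :=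
  (W <= V)%VS && (\dim W == 2%N).

Definition proj_span (K : fieldType) (E : vectType K) (V : {vspace E})
    (s : seq (proj V)) : {vspace E} := (\sum_(p <- s) sval p)%VS.

Definition collinear (K : fieldType) (E : vectType K) (V : {vspace E})
    (s : seq (proj V)) : Prop :=
  exists W : {vspace E}, is_line V W /\ all (fun p => lies_on p W) s.

(* A (p_g, l_k)-configuration: p distinct points and l distinct lines of P(V)
   such that exactly g of the lines pass through each point and exactly k of
   the points lie on each line. *)
Record is_configuration (K : fieldType) (E : vectType K) (V : {vspace E})
    (p g l k : nat) (I J : finType)
    (pt : I -> proj V) (ln : J -> {vspace E}) : Prop := IsConfiguration {
  conf_card_points : #|I| = p;
  conf_points_inj : injective pt;
  conf_card_lines : #|J| = l;
  conf_lines_inj : injective ln;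
  conf_lines : forall j, is_line V (ln j);
  conf_lines_through : forall i, #|[set j | lies_on (pt i) (ln j)]| = g;
  conf_points_on : forall j, #|[set i | lies_on (pt i) (ln j)]| = k
}.

(* The index set {1, ..., 6} is represented by 'I_6 = {0, ..., 5}. *)
Definition duad : finType := {A : {set 'I_6} | #|A| == 2%N}.

Definition is_syntheme (S : {set {set 'I_6}}) : bool :=
  [&& partition S [set: 'I_6], #|S| == 3%N & [forall A in S, #|A| == 2%N]].

Definition syntheme : finType := {S : {set {set 'I_6}} | is_syntheme S}.

Definition coord_sum (R : realType) (x : 'rV[R[i]]_6) : R[i]^o :=
  \sum_(i < 6) x 0 i.

Lemma coord_sum_linear (R : realType) : linear (@coord_sum R).
Proof.
move=> a x y; rewrite /coord_sum scaler_sumr -big_split /=.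
by apply: eq_bigr => i _; rewrite !mxE.
Qed.

HB.instance Definition _ (R : realType) :=
  GRing.isLinear.Build R[i] 'rV[R[i]]_6 R[i]^o _ (@coord_sum R)
    (@coord_sum_linear R).

Definition hyperV (R : realType) : {vspace 'rV[R[i]]_6} :=
  lker (linfun (@coord_sum R)).

Lemma mem_hyperV (R : realType) (x : 'rV[R[i]]_6) :
  (x \in hyperV R) = (\sum_(i < 6) x 0 i == 0).
Proof. by rewrite memv_ker lfunE. Qed.

Definition basis_vec (R : realType) (i : 'I_6) : 'rV[R[i]]_6 := delta_mx 0 i.

(* For A = {a, b} this is v_ab = e_a + e_b - (e_1 + ... + e_6) / 3; see
   duad_vec_pair. *)
Definition duad_vec (R : realType) (A : {set 'I_6}) : 'rV[R[i]]_6 :=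
  \sum_(i in A) basis_vec R i - 3%:R^-1 *: \sum_(i < 6) basis_vec R i.

Lemma duad_vec_pair (R : realType) (i j : 'I_6) : i != j ->
  duad_vec R [set i; j] = basis_vec R i + basis_vec R j
                    - 3%:R^-1 *: \sum_(k < 6) basis_vec R k.
Proof. by move=> ij; rewrite /duad_vec big_setU1 ?inE //= big_set1. Qed.

Lemma duad_vecE (R : realType) (A : {set 'I_6}) (k : 'I_6) :
  duad_vec R A 0 k = (k \in A)%:R - 3%:R^-1.
Proof.
have H (B : {set 'I_6}) :
    (\sum_(i in B) basis_vec R i) 0 k = (k \in B)%:R :> R[i].
  rewrite summxE; case: (boolP (k \in B)) => kB.
    rewrite (bigD1 k) //= mxE !eqxx big1 ?addr0 // => i /andP[_ ik].
    by rewrite mxE eqxx eq_sym (negbTE ik).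
  rewrite big1 // => i iB; rewrite mxE eqxx /=.
  by case: eqP => // ki; rewrite ki iB in kB.
have := H [set: 'I_6]; rewrite inE => H6.
rewrite /duad_vec mxE H; congr (_ + _).
rewrite !mxE -[RHS]mulr1 mulNr; congr (- (_ * _)); rewrite -[RHS]H6.
by congr (fun_of_matrix _ _ _); apply: eq_bigl => i; rewrite inE.
Qed.

Lemma duad_vec_in_hyperV (R : realType) (A : duad) :
  duad_vec R (val A) \in hyperV R.
Proof.
rewrite mem_hyperV; under eq_bigr => k _ do rewrite duad_vecE.
rewrite big_split /= -natr_sum sumr_const card_ord.
have -> : (\sum_(i < 6) (i \in val A) = 2)%N.
  by rewrite -big_mkcond sum1_card (eqP (valP A)).
rewrite mulNrn -[_^-1 *+ _]mulr_natr (natrM _ 3 2) mulrA mulVf ?pnatr_eq0 //.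
by rewrite mul1r subrr.
Qed.

Lemma duad_vec_neq0 (R : realType) (A : duad) : duad_vec R (val A) != 0.
Proof.
have /subsetPn[k _ kA] : ~~ ([set: 'I_6] \subset val A).
  by apply/negP => /subset_leq_card; rewrite cardsT card_ord (eqP (valP A)).
apply/eqP => /rowP/(_ k); rewrite duad_vecE mxE (negbTE kA) add0r.
by apply/eqP; rewrite oppr_eq0 invr_eq0 pnatr_eq0.
Qed.

Definition duad_pt (R : realType) (A : duad) : proj (hyperV R) :=
  proj_pt (duad_vec_in_hyperV R A) (duad_vec_neq0 R A).

(* L_(ab|cd|ef), the span of z_ab, z_cd and z_ef *)
Definition syntheme_line (R : realType) (S : syntheme) :
    {vspace 'rV[R[i]]_6} :=
  proj_span [seq duad_pt R A | A <- enum duad & val A \in val S].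

(* Main.v *)
Require Import Defs.
From HB Require Import structures.
From mathcomp Require Import all_boot all_order all_algebra.
From mathcomp Require Import reals.
From mathcomp Require Import complex.

(** The proof rests on one computation.  The coordinate of [v_A] at [k] is
    [1_A(k) - 1/3].  Suppose that [v_C = a v_A + b v_B] with [C] different from
    [A] and [B], and that some point of {1,...,6} is missed by [A], [B] and [C].
    Reading the relation there gives [a + b = 1], so the terms [1/3] cancel and
    the relation becomes [1_C = a 1_A + b 1_B].  At a point of [A] outside [C]
    this reads [a = 0] or [a + b = 0]; the latter is absurd, and the former
    forces [b = 1], hence [C = B].  So [A], [B], [C] cover the six indices
    ([duad_vec_span_cover]), which for three pairs means that they are disjoint
    and form a syntheme.  Conversely, if they do, then the indicators add up to 1
    and [v_A + v_B + v_C = 0] ([syntheme_duad_vec_sum]).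

    Taking [A = B] in the computation shows that distinct duads give
    independent vectors, since two pairs cannot cover six indices.  Therefore the
    span of two distinct points [z_A], [z_B] is a line, it contains a third
    point [z_C] exactly when [A], [B], [C] form a syntheme, and the line of a
    syntheme is the span of any two of its points.  Incidence between the points
    and the lines is thus membership of duads in synthemes ([lies_on_syntheme]),
    and the rest is counting: a duad lies in three synthemes, because such a
    syntheme amounts to the choice of the partner of a fixed index outside the
    duad, and counting the incident pairs in two ways turns the 15 duads into
    15 synthemes. *)

Set Implicit Arguments.
Unset Strict Implicit.
Unset Printing Implicit Defensive.

Import GRing.Theory Num.Theory.
Local Open Scope ring_scope.

(** * Duads and synthemes *)

Lemma card_duad_val (A : duad) : #|val A| = 2%N.
Proof. exact: eqP (valP A). Qed.

Lemma duad_subset_eq (A B : duad) : val A \subset val B -> A = B.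
Proof.
by move=> sAB; apply/val_inj/eqP; rewrite eqEcard sAB !card_duad_val.
Qed.

Lemma card_duad : #|duad| = 15%N.
Proof.
rewrite card_sig -[15%N]/('C(6, 2)) -[in RHS](card_ord 6) -card_draws.
by apply: eq_card => A; rewrite !inE.
Qed.

Lemma two_duads_not_cover (A B : duad) : val A :|: val B != [set: 'I_6].
Proof.
apply/eqP => cAB; have := (leq_card_setU (val A) (val B)).1.
by rewrite cAB cardsT card_ord !card_duad_val.
Qed.

Lemma cover_set3 (T : finType) (A B C : {set T}) :
  cover [set A; B; C] = A :|: B :|: C.
Proof. by rewrite /cover !bigcup_setU !big_set1. Qed.

Lemma cards3 (T : finType) (a b c : T) :
  a != b -> a != c -> b != c -> #|[set a; b; c]| = 3%N.
Proof.
move=> ab ac bc.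
by rewrite setUC cardsU1 !inE negb_or ![c == _]eq_sym ac bc cards2 ab.
Qed.

(** Disjointness is automatic: three pairs have six elements in all, counted
    with multiplicity, so if they cover six indices nothing is covered twice. *)
Lemma is_syntheme_cover (A B C : duad) : A != B -> A != C -> B != C ->
  is_syntheme [set val A; val B; val C]
  = (val A :|: val B :|: val C == [set: 'I_6]).
Proof.
move=> AB AC BC; rewrite /is_syntheme /partition cover_set3.
have c3 : #|[set val A; val B; val C]| = 3%N by rewrite cards3.
have card2 X : X \in [set val A; val B; val C] -> #|X| = 2%N.
  by rewrite !inE => /orP[/orP[]|] /eqP->; apply: card_duad_val.
rewrite c3 eqxx /=.
have -> : [forall X in [set val A; val B; val C], #|X| == 2%N].
  by apply/forall_inP => X /card2/eqP.
rewrite andbT; case: eqP => //= cov; apply/andP; split.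
  have := leq_card_cover [set val A; val B; val C].
  rewrite cover_set3 cov cardsT card_ord (eq_bigr (fun=> 2%N)) //.
  by rewrite sum_nat_const c3 => -[_ <-].
by apply/negP => /card2; rewrite cards0.
Qed.

(** By counting, since [A] and [B] leave at least two of the six indices to [C]. *)
Lemma cover_duad_third (A B C : duad) :
  val A :|: val B :|: val C = [set: 'I_6] -> val C = ~: (val A :|: val B).
Proof.
move=> cov; apply/esym/eqP; rewrite eqEcard card_duad_val; apply/andP; split.
  apply/subsetP => k; have := in_setT k; rewrite -cov !inE => /orP[kAB|//].
  by rewrite kAB.
have := (leq_card_setU (val A) (val B)).1; rewrite !card_duad_val => le4.
by rewrite -(leq_add2l #|val A :|: val B|) cardsC card_ord -[6%N]/(4 + 2)%N
           leq_add2r.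
Qed.

Lemma is_synthemeP (S : {set {set 'I_6}}) : is_syntheme S ->
  exists A B C : duad, [/\ A != B, A != C, B != C
    & S = [set val A; val B; val C]].
Proof.
move=> synS; have /and3P[_ /eqP card3 /forall_inP card2] := synS.
have [X XS] : exists X, X \in S by apply/card_gt0P; rewrite card3.
have : #|S :\ X| == 2%N.
  by move: card3; rewrite (cardsD1 X) XS add1n => -[->].
move=> /cards2P[Y [Z [YZ SX]]].
have [YS XY] : Y \in S /\ Y != X.
  have: Y \in S :\ X by rewrite SX set21.
  by rewrite !inE => /andP[].
have [ZS XZ] : Z \in S /\ Z != X.
  have: Z \in S :\ X by rewrite SX set22.
  by rewrite !inE => /andP[].
exists (exist _ X (card2 X XS)), (exist _ Y (card2 Y YS)).
exists (exist _ Z (card2 Z ZS)).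
split; last by rewrite -(setD1K XS) SX setUA.
- by rewrite -val_eqE /= eq_sym.
- by rewrite -val_eqE /= eq_sym.
- by rewrite -val_eqE.
Qed.

Lemma syntheme_cover (S : syntheme) (A B C : duad) :
  A != B -> A != C -> B != C -> val S = [set val A; val B; val C] ->
  val A :|: val B :|: val C = [set: 'I_6].
Proof.
by move=> AB AC BC eS; apply/eqP; rewrite -is_syntheme_cover // -eS (valP S).
Qed.

Lemma card_duads_in_syntheme (S : syntheme) :
  #|[set A : duad | val A \in val S]| = 3%N.
Proof.
have [A [B [C [AB AC BC ->]]]] := is_synthemeP (valP S).
apply: etrans (cards3 AB AC BC); apply: eq_card => X.
by rewrite !inE.
Qed.

Lemma syntheme_two_duads (S : syntheme) (A B : duad) :
  val A \in val S -> val B \in val S -> val A != val B ->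
  val S = [set val A; val B; ~: (val A :|: val B)].
Proof.
move=> AS BS AB; have /and3P[_ /eqP card3 /forall_inP card2] := valP S.
have [C] : exists C, C \in val S :\: [set val A; val B].
  apply/card_gt0P; rewrite cardsD card3 (setIidPr _) ?cards2 ?AB //.
  by apply/subsetP => Z; rewrite !inE => /orP[] /eqP->.
rewrite !inE negb_or => /andP[/andP[CA CB] CS].
pose C' : duad := exist _ C (card2 _ CS).
have eS : val S = [set val A; val B; val C'].
  apply/esym/eqP; rewrite eqEcard card3 cards3 ?(eq_sym _ C) // andbT.
  by apply/subsetP => Z; rewrite !inE => /orP[/orP[]|] /eqP->.
rewrite eS (@cover_duad_third A B C') //.
by apply: (@syntheme_cover S) => //; rewrite -val_eqE //= eq_sym.
Qed.

Definition syntheme_with_pair (A : {set 'I_6}) (x y : 'I_6) :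
    {set {set 'I_6}} :=
  [set A; [set x; y]; ~: (A :|: [set x; y])].

Lemma syntheme_with_pairP (A : duad) (x y : 'I_6) :
  x \notin val A -> y \notin val A -> y != x ->
  is_syntheme (syntheme_with_pair (val A) x y).
Proof.
move=> xA yA yx.
have cB : #|[set x; y]| == 2%N by rewrite cards2 (eq_sym x) yx.
have disj : [disjoint val A & [set x; y]].
  by rewrite disjoint_sym disjoints_subset subUset !sub1set !inE xA yA.
have cC : #|~: (val A :|: [set x; y])| == 2%N.
  rewrite cardsCs setCK card_ord; move: (leq_card_setU (val A) [set x; y]).
  by case=> _; rewrite disj => /eqP ->; rewrite card_duad_val (eqP cB).
pose B : duad := exist _ [set x; y] cB.
pose C : duad := exist _ (~: (val A :|: [set x; y])) cC.
rewrite (@is_syntheme_cover A B C) /=; first by rewrite setUCr.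
- by apply: contraNneq xA => ->; rewrite /= set21.
- apply/eqP => AC; have : #|val A :&: val C| = 0%N.
    by rewrite /= setCU setIA setICr set0I cards0.
  by rewrite -AC setIid card_duad_val.
- apply/eqP => /(congr1 val)/setP/(_ x) /=.
  by rewrite !inE eqxx orbT.
Qed.

(** With [x] outside [A] fixed, a syntheme through [A] is determined by the
    partner of [x], which is any of the three other indices outside [A]. *)
Lemma card_synthemes_through_duad (A : duad) :
  #|[set S : syntheme | val A \in val S]| = 3%N.
Proof.
have cA : #|~: val A| = 4%N by rewrite cardsCs setCK card_ord card_duad_val.
have [x xA] : exists x, x \in ~: val A by apply/card_gt0P; rewrite cA.
have c3 : #|~: val A :\ x| = 3%N.
  by move: cA; rewrite (cardsD1 x) xA add1n => -[].
rewrite inE in xA.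
rewrite -(card_imset _ (@val_inj _ _ syntheme)); apply: etrans c3.
have injf : {in ~: val A :\ x &, injective (syntheme_with_pair (val A) x)}.
  move=> y z; rewrite !inE => /andP[yx yA] /andP[zx zA] eyz.
  have : [set x; y] \in syntheme_with_pair (val A) x z.
    by rewrite -eyz !inE eqxx orbT.
  rewrite !inE => /orP[/orP[]|] /eqP/setP e.
  - by have := e x; rewrite !inE eqxx (negbTE xA).
  - by have := e y; rewrite !inE eqxx orbT (negbTE yx) => /esym/eqP.
  - by have := e x; rewrite !inE eqxx orbT.
rewrite -(card_in_imset injf); congr #|pred_of_set _|; apply/setP => T.
apply/imsetP/imsetP.
- case=> S; rewrite inE => AS ->.
  have /and3P[/and3P[/eqP cov triv _] _ /forall_inP card2] := valP S.
  have xS : x \in cover (val S) by rewrite cov inE.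
  have [B BS xB] : exists2 B : duad, val B \in val S & x \in val B.
    have BS := pblock_mem xS.
    exists (exist _ (pblock (val S) x) (card2 _ BS)) => //.
    by rewrite /= mem_pblock.
  have : #|val B :\ x| == 1%N.
    by have := card_duad_val B; rewrite (cardsD1 x) xB add1n => -[->].
  case/cards1P => y eBx.
  have eB : val B = [set x; y] by rewrite -(setD1K xB) eBx.
  have AB : val A != val B by apply: contraNneq xA => ->.
  have /setP/(_ y) : val A :&: val B = set0.
    by apply/disjoint_setI0; apply: (trivIsetP triv).
  rewrite !inE eB !inE eqxx orbT andbT => yA.
  have : y \in val B :\ x by rewrite eBx set11.
  rewrite !inE => /andP[yx _].
  exists y; first by rewrite !inE yx yA.
  by rewrite (syntheme_two_duads AS BS AB) eB.
- case=> y; rewrite !inE => /andP[yx yA] ->.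
  exists (exist is_syntheme _ (syntheme_with_pairP xA yA yx)) => //.
  by rewrite inE /= !inE eqxx.
Qed.

(** Count the pairs (duad, syntheme containing it): [15 * 3] by duads, and
    three times the number of synthemes by synthemes. *)
Lemma card_syntheme : #|syntheme| = 15%N.
Proof.
apply/eqP; rewrite -(@eqn_pmul2r 3) //; apply/eqP.
transitivity (#|duad| * 3)%N; last by rewrite card_duad.
rewrite -!sum_nat_const.
under eq_bigr => S _ do rewrite -(card_duads_in_syntheme S).
under [RHS]eq_bigr => A _ do rewrite -(card_synthemes_through_duad A).
under eq_bigr do rewrite -sum1dep_card big_mkcond.
under [RHS]eq_bigr do rewrite -sum1dep_card big_mkcond.
exact: exchange_big.
Qed.

(** * Linear relations between the duad vectors *)

(** An index [k0] outside the three duads forces [a + b = 1] in the relation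
    [v_C = a v_A + b v_B], which then holds between the indicators; an index of
    [A] outside [C] and an index of [C] outside [B] give the contradiction.
    The case [A = B] is included so that it also yields the independence of two
    duad vectors. *)
Lemma duad_vec_span_cover (R : realType) (A B C : duad) :
  C != A -> C != B ->
  duad_vec R (val C)
    \in (<[duad_vec R (val A)]> + <[duad_vec R (val B)]>)%VS ->
  val A :|: val B :|: val C = [set: 'I_6].
Proof.
move=> CA CB /memv_addP[_ /vlineP[a ->] [_ /vlineP[b ->] rel]].
apply/eqP; rewrite -subTset; apply/subsetP => k0 _; apply/contraT.
rewrite !inE !negb_or => /andP[/andP[k0A k0B] k0C].
have relk k : (k \in val C)%:R - 3^-1
    = a * ((k \in val A)%:R - 3^-1) + b * ((k \in val B)%:R - 3^-1) :> R[i]%C.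
  have combE (u v : 'rV[R[i]%C]_6) : (a *: u + b *: v) 0 k
      = a * u 0 k + b * v 0 k.
    by rewrite !mxE.
  by rewrite -!duad_vecE rel combE.
have ab1 : a + b = 1.
  have := relk k0.
  rewrite (negbTE k0A) (negbTE k0B) (negbTE k0C) !sub0r -mulrDl => /eqP.
  rewrite mulrN eqr_opp -{1}[3^-1]mul1r => /eqP/mulIf -> //.
  by rewrite invr_eq0 pnatr_eq0.
have ind k : (k \in val C)%:R = a * (k \in val A)%:R + b * (k \in val B)%:R
    :> R[i]%C.
  move: (relk k); rewrite !mulrBr addrACA -opprD -mulrDl ab1 mul1r.
  exact: addIr.
have /subsetPn[k kA kC] : ~~ (val A \subset val C).
  by apply: contraNN CA => /duad_subset_eq ->.
move: (ind k); rewrite kA (negbTE kC) mulr1.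
case: (k \in val B).
  by rewrite mulr1 ab1 => /eqP; rewrite eq_sym oner_eq0.
rewrite mulr0 addr0 => /esym a0; rewrite a0 add0r in ab1.
case/eqP: CB; apply/duad_subset_eq/subsetP => j jC.
have := ind j; rewrite jC a0 ab1 mul0r add0r mul1r => /eqP.
by case: (j \in val B); rewrite ?oner_eq0.
Qed.

(** Each index lies in exactly one of the duads, so that each coordinate of the
    sum is [1 - 3 * (1/3)]. *)
Lemma syntheme_duad_vec_sum (R : realType) (A B C : duad) :
  val A :|: val B :|: val C = [set: 'I_6] ->
  duad_vec R (val A) + duad_vec R (val B) + duad_vec R (val C) = 0.
Proof.
move=> cov; have eC := cover_duad_third cov.
have eB : val B = ~: (val A :|: val C).
  by apply: cover_duad_third; rewrite setUAC.
have addE (u v w : 'rV[R[i]%C]_6) k : (u + v + w) 0 k = u 0 k + v 0 k + w 0 k.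
  by rewrite !mxE.
apply/rowP => k; rewrite addE !duad_vecE mxE.
have nAB : (k \in val A) && (k \in val B) = false.
  by rewrite eB !inE; case: (k \in val A).
have -> : (k \in val C) = ~~ ((k \in val A) || (k \in val B)).
  by rewrite eC !inE.
have three : 3^-1 + 3^-1 + 3^-1 = 1 :> R[i]%C.
  have -> : 3^-1 + 3^-1 + 3^-1 = 3^-1 *+ 3 :> R[i]%C.
    by rewrite -addrA -mulr2n -mulrS.
  by rewrite -[LHS]mulr_natr mulVf ?pnatr_eq0.
have regroup (a b c t : R[i]%C) : (a - t) + (b - t) + (c - t)
    = a + b + c - (t + t + t).
  by rewrite !opprD [RHS]addrACA [a + b + _]addrACA.
rewrite regroup three.
by case: (k \in val A) (k \in val B) nAB => [] [] //= _;
  rewrite ?addr0 ?add0r subrr.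
Qed.

(** * Lines through two of the points *)

Definition duad_line (R : realType) (A B : duad) : {vspace 'rV[R[i]%C]_6} :=
  (<[duad_vec R (val A)]> + <[duad_vec R (val B)]>)%VS.

(** Otherwise [A], [A] and [B] would cover the six indices. *)
Lemma duad_vec_notin_line (R : realType) (A B : duad) :
  A != B -> duad_vec R (val B) \notin <[duad_vec R (val A)]>%VS.
Proof.
move=> AB; apply/negP; rewrite -[<[_]>%VS]addvv => BA.
have BnA : B != A by rewrite eq_sym.
have := duad_vec_span_cover BnA BnA BA.
by rewrite setUid => /eqP; rewrite (negbTE (two_duads_not_cover A B)).
Qed.

Lemma dim_duad_line (R : realType) (A B : duad) :
  A != B -> \dim (duad_line R A B) = 2%N.
Proof.
move=> AB; apply/eqP; rewrite eqn_leq; apply/andP; split.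
  apply: leq_trans (dimv_add_leqif _ _) _.
  by rewrite !dim_vline !duad_vec_neq0.
rewrite ltnNge; apply: contra (duad_vec_notin_line R AB) => le1.
have /eqP -> : <[duad_vec R (val A)]>%VS == duad_line R A B.
  by rewrite eqEdim addvSl dim_vline duad_vec_neq0.
by rewrite memvE addvSr.
Qed.

Lemma duad_line_is_line (R : realType) (A B : duad) :
  A != B -> is_line (hyperV R) (duad_line R A B).
Proof.
move=> AB; rewrite /is_line dim_duad_line // eqxx andbT subv_add -!memvE.
by rewrite !duad_vec_in_hyperV.
Qed.

Lemma duad_line_third (R : realType) (A B C : duad) : C != A -> C != B ->
  (duad_vec R (val C) \in duad_line R A B)
  = (val A :|: val B :|: val C == [set: 'I_6]).
Proof.
move=> CA CB; apply/idP/eqP; first exact: duad_vec_span_cover.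
move/(syntheme_duad_vec_sum R)/eqP; rewrite addrC addr_eq0 => /eqP ->.
by rewrite memvN memv_add // memv_line.
Qed.

(** Two distinct points lie on only one line, by comparison of dimensions. *)
Lemma collinear_duads (R : realType) (A B C : duad) : A != B ->
  collinear [:: duad_pt R A; duad_pt R B; duad_pt R C]
  <-> duad_vec R (val C) \in duad_line R A B.
Proof.
move=> AB; split.
  case=> W [/andP[_ /eqP dimW] /and4P[AW BW CW _]].
  have /eqP -> : duad_line R A B == W.
    by rewrite eqEdim dimW dim_duad_line // andbT subv_add; apply/andP.
  by rewrite memvE.
move=> CL; exists (duad_line R A B); split; first exact: duad_line_is_line.
by rewrite /= /lies_on /= addvSl addvSr -memvE CL.
Qed.

(** * The lines of the synthemes *)

Lemma syntheme_lineE (R : realType) (S : syntheme) (A B C : duad) :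
  A != B -> A != C -> B != C -> val S = [set val A; val B; val C] ->
  syntheme_line R S = duad_line R A B.
Proof.
move=> AB AC BC eS; have cov := syntheme_cover AB AC BC eS.
have eL : syntheme_line R S
    = (\sum_(X : duad | val X \in val S) <[duad_vec R (val X)]>)%VS.
  by rewrite /syntheme_line /proj_span big_map big_filter big_enum_cond.
rewrite eL; apply/eqP; rewrite eqEsubv; apply/andP; split.
  apply/subv_sumP => X; rewrite eS !inE !val_eqE -memvE.
  case/orP => [/orP[]|] /eqP ->.
  - by rewrite memvE addvSl.
  - by rewrite memvE addvSr.
  - by rewrite duad_line_third ?cov 1?eq_sym.
by rewrite subv_add !(sumv_sup _ _ (subvv _)) // eS !inE eqxx ?orbT.
Qed.

Lemma lies_on_syntheme (R : realType) (S : syntheme) (X : duad) :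
  lies_on (duad_pt R X) (syntheme_line R S) = (val X \in val S).
Proof.
have [A [B [C [AB AC BC eS]]]] := is_synthemeP (valP S).
have cov := syntheme_cover AB AC BC eS.
rewrite /lies_on /= (syntheme_lineE R AB AC BC eS) -memvE eS !inE !val_eqE.
have [->|XA] := eqVneq X A; first by rewrite memvE addvSl.
have [->|XB] := eqVneq X B; first by rewrite memvE addvSr.
rewrite duad_line_third //=; apply/eqP/eqP => [covX|->//].
by apply: val_inj; rewrite (cover_duad_third covX) (cover_duad_third cov).
Qed.

Lemma duad_pt_inj (R : realType) : injective (@duad_pt R).
Proof.
move=> A B /(congr1 sval) /= eAB; apply/eqP/contraT => /(duad_vec_notin_line R).
by rewrite eAB memv_line.
Qed.

(** A syntheme is recovered from its line as the set of duads whose points lie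
    on it. *)
Lemma syntheme_line_inj (R : realType) : injective (@syntheme_line R).
Proof.
have sub (S T : syntheme) : syntheme_line R S = syntheme_line R T ->
    {subset val S <= val T}.
  move=> eST X XS; have /and3P[_ _ /forall_inP/(_ X XS) cX] := valP S.
  by move: XS; rewrite -!(lies_on_syntheme R _ (exist _ X cX)) eST.
move=> S T eST; apply/val_inj/setP => X.
by apply/idP/idP; apply: sub.
Qed.

Theorem proposition8 (R : realType) :
  (forall A B C : duad, A != B -> A != C -> B != C ->
     collinear [:: duad_pt R A; duad_pt R B; duad_pt R C]
     <-> is_syntheme [set val A; val B; val C])
  /\ is_configuration 15 3 15 3 (@duad_pt R) (@syntheme_line R).
Proof.
split=> [A B C AB AC BC|].
  rewrite is_syntheme_cover // -(duad_line_third R) 1?eq_sym //.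
  exact: collinear_duads.
split.
- exact: card_duad.
- exact: duad_pt_inj.
- exact: card_syntheme.
- exact: syntheme_line_inj.
- move=> S; have [A [B [C [AB AC BC eS]]]] := is_synthemeP (valP S).
  by rewrite (syntheme_lineE R AB AC BC eS); apply: duad_line_is_line.
- move=> A; apply: etrans (card_synthemes_through_duad A); apply: eq_card => S.
  by rewrite !inE lies_on_syntheme.
- move=> S; apply: etrans (card_duads_in_syntheme S); apply: eq_card => A.
  by rewrite !inE lies_on_syntheme.
Qed.
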